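(* Let $r$ be a fixed integer with $r\equiv2\ (\mathrm{mod}\ 4)$, let $g$ be a non-zero integer, and let $E/\mathbb{Q}$ be the elliptic curve $y^2=4x^3-\frac{40}{3}g^2x-\frac{224}{27}g^3$ (with CM by $\mathbb{Q}(\sqrt{-2})$). Then $\varpi_{E,r}$ is always positive.
   Context: Write $g=(-1)^\delta2^\lambda g_1$ with $\delta\in\{0,1\}$, $\lambda\geqslant0$ an integer, $g_1\geqslant1$ odd. For $r\equiv2$ mod $4$, $$\varpi_{E,r}=\frac{h_{2,r}}{2}\Big(1+\frac12(-1)^{\frac{(r-2)(r+10)}{32}+\delta+\lambda+\frac{g_1-1}{2}}\Big(\frac2{g_1}\Big)\Omega_2(2;g_1,r)\Big),$$ where $\Omega_2(2;g_1,r)=\prod_{p^\nu\parallel g_1,\ p\nmid r,\ 2\nmid\nu}\frac{-1}{p-1-(\frac{-2}{p})}$ (empty product $=1$), $h_{2,r}=\sqrt2\prod_{p\nmid2r}\big(1-\frac{(\frac{-2}{p})}{p-1}\big)$ (product over primes in increasing order), and $(\frac\cdot\cdot)$ is the Legendre/Jacobi symbol. *)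

(* Defs.v *)
From HB Require Import structures.
From mathcomp Require Import all_boot all_order all_algebra.
From mathcomp Require Import all_classical all_reals all_analysis.
From mathcomp Require Import ring.
Import Order.TTheory GRing.Theory Num.Theory.
Import numFieldNormedType.Exports.

Set Implicit Arguments.
Unset Strict Implicit.
Unset Printing Implicit Defensive.

Local Open Scope classical_set_scope.
Local Open Scope ring_scope.

(* An elliptic curve over Q, given by y^2 = 4 x^3 - wg2 * x - wg3. *)
Record ellipticCurve := EllipticCurve {
  wg2 : rat;
  wg3 : rat;
  disc_neq0 : wg2 ^+ 3 - 27 * wg3 ^+ 2 != 0 }.

Definition cm2_g2 (g : int) : rat := 40 / 3 * g%:~R ^+ 2.
Definition cm2_g3 (g : int) : rat := 224 / 27 * g%:~R ^+ 3.

Lemma cm2_disc_neq0_field (F : numFieldType) (x : F) : x != 0 ->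
  (40 / 3 * x ^+ 2) ^+ 3 - 27 * (224 / 27 * x ^+ 3) ^+ 2 != 0.
Proof.
move=> x0.
have -> : (40 / 3 * x ^+ 2) ^+ 3 - 27 * (224 / 27 * x ^+ 3) ^+ 2 = 512 * x ^+ 6.
  by field; rewrite ?pnatr_eq0.
by apply: mulf_neq0; [rewrite pnatr_eq0|apply: expf_neq0].
Qed.

Lemma cm2_disc_neq0 (g : int) :
  g != 0 -> cm2_g2 g ^+ 3 - 27 * cm2_g3 g ^+ 2 != 0.
Proof. by rewrite -(intr_eq0 rat); apply: cm2_disc_neq0_field. Qed.

Definition cm2_curve (g : int) (hg : g != 0) : ellipticCurve :=
  EllipticCurve (cm2_disc_neq0 hg).

(* The integer g such that E is y^2 = 4x^3 - (40/3) g^2 x - (224/27) g^3;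
   it is determined by the coefficients of E (see cm2_twist_curve). *)
Definition cm2_twist (E : ellipticCurve) : int :=
  xget 0 [set g : int | wg2 E = cm2_g2 g /\ wg3 E = cm2_g3 g].

Lemma scale23_inj (F : fieldType) (c d x y : F) : c != 0 -> d != 0 -> x != 0 ->
  c * x ^+ 2 = c * y ^+ 2 -> d * x ^+ 3 = d * y ^+ 3 -> x = y.
Proof.
move=> c0 d0 x0 /(mulfI c0) e2 /(mulfI d0) e3.
apply: (@mulIf _ (x ^+ 2)); first by rewrite expf_neq0.
by rewrite {2}e2 -!exprS.
Qed.

Lemma cm2_coef_inj (F : numFieldType) (x y : F) : x != 0 ->
  40 / 3 * x ^+ 2 = 40 / 3 * y ^+ 2 -> 224 / 27 * x ^+ 3 = 224 / 27 * y ^+ 3 ->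
  x = y.
Proof.
by apply: scale23_inj; apply: mulf_neq0; rewrite ?invr_eq0 pnatr_eq0.
Qed.

Lemma cm2_twist_uniq (E : ellipticCurve) (g : int) : g != 0 ->
  wg2 E = cm2_g2 g -> wg3 E = cm2_g3 g -> cm2_twist E = g.
Proof.
move=> hg E2 E3; rewrite /cm2_twist.
have Eg : [set g | wg2 E = cm2_g2 g /\ wg3 E = cm2_g3 g] g by split.
move: (xgetPex 0 (ex_intro _ g Eg)); move: (xget _ _) => h [].
rewrite E2 E3 /cm2_g2 /cm2_g3 => e2 e3.
have g0 : g%:~R != 0 :> rat by rewrite intr_eq0.
have /eqP := cm2_coef_inj g0 e2 e3.
by rewrite eqr_int eq_sym => /eqP.
Qed.

Lemma cm2_twist_curve (g : int) (hg : g != 0) :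
  cm2_twist (cm2_curve hg) = g.
Proof. exact: cm2_twist_uniq. Qed.

(* g = (-1)^delta * 2^lambda * g_1 with g_1 >= 1 odd; see sgn2_decomp. *)
Definition sgn_exp (g : int) : nat := (g < 0)%R.
Definition two_exp (g : int) : nat := logn 2 `|g|%N.
Definition odd_part (g : int) : nat := (partn `|g| 2^')%N.

Lemma sgn2_decomp (g : int) : g != 0 ->
  g = (-1) ^+ sgn_exp g * 2 ^+ two_exp g * (odd_part g)%:Z /\ odd (odd_part g).
Proof.
move=> g0; split; last by rewrite odd_2'nat part_pnat.
rewrite {1}[g]intEsign -mulrA; congr (_ * _).
have -> : (2 : int) ^+ two_exp g = (2 ^ two_exp g)%N%:Z by rewrite -natz natrX.
by rewrite -PoszM -{1}(@partnC 2%N `|g|%N) ?absz_gt0 // p_part.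
Qed.

(* Legendre symbol (a / p), for p an odd prime. *)
Definition legendre (a : int) (p : nat) : int :=
  if (p %| a)%Z then 0
  else if [exists x : 'I_p, ((x : nat)%:Z ^+ 2 == a %[mod p])%Z] then 1 else -1.

(* Jacobi symbol (a / n), for n odd and positive. *)
Definition jacobi (a : int) (n : nat) : int :=
  \prod_(p <- primes n) legendre a p ^+ logn p n.

Definition Omega2 (R : realType) (g1 : nat) (r : int) : R :=
  \prod_(p <- primes g1 | ~~ (p %| r)%Z && odd (logn p g1))
    (-1 / (p%:R - 1 - (legendre (-2) p)%:~R)).

Definition h2_partial (R : realType) (r : int) (N : nat) : R :=
  \prod_(0 <= p < N | prime p && ~~ (p %| 2 * r)%Z)
    (1 - (legendre (-2) p)%:~R / (p%:R - 1)).

(* The product over primes is only conditionally convergent, hence the limit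
   of partial products over p < N. The lim of a divergent real sequence is 0, so
   the positivity of h2 (hence that of varpi) entails convergence. *)
Definition h2 (R : realType) (r : int) : R :=
  Num.sqrt 2 * lim (h2_partial R r @ \oo).

(* For r = 2 mod 4, 32 divides (r - 2)(r + 10), so the first quotient is exact;
   it may be negative, whence the integer exponent. *)
Definition varpi_sign_exp (g r : int) : int :=
  ((r - 2) * (r + 10) %/ 32)%Z
    + (sgn_exp g + two_exp g + (odd_part g).-1 %/ 2)%N%:Z.

(* The constant varpi_{E,r}, meaningful for r = 2 mod 4 and E = cm2_curve _. *)
Definition varpi (R : realType) (E : ellipticCurve) (r : int) : R :=
  let g := cm2_twist E in
  let g1 := odd_part g in
  h2 R r / 2 *
  (1 + 1 / 2 * (-1) ^ varpi_sign_exp g r * (jacobi 2 g1)%:~R * Omega2 R g1 r).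

(* Main.v *)
Require Import Defs.
From mathcomp Require Import all_boot all_order all_algebra.
From mathcomp Require Import fingroup cyclic finfield.
From mathcomp Require Import all_classical all_reals all_analysis.
From mathcomp Require Import zify ring lra.
Import Order.TTheory GRing.Theory Num.Theory.
Import numFieldNormedType.Exports.
Local Open Scope ring_scope.

(* In the bracket, |Omega2| <= 1 because p - 1 - (-2/p) >= 1 for every prime p,
   so the bracket is at least 1/2, and everything rests on the convergence of
   the conditionally convergent product h2 to a positive limit. By Gauss's
   lemma (-2/p) = chi8(p) for a character chi8 modulo 8, and Mertens' method
   applies: expanding ln n over prime powers turns the bounded sum
   sum_(n <= N) chi8(n) (ln n) / n into
   L(1, chi8) * sum_(p^k <= N) chi8(p^k) (ln p) / p^k, up to an error
   controlled by Chebyshev's bound psi(N) = O(N). Since L(1, chi8) > 0, the sums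
   sum_(p <= N) chi8(p) (ln p) / p are bounded; Abel summation against
   1 / ln p then gives the convergence of sum_p chi8(p) / p, and the logarithm
   of the product differs from minus this series by an absolutely convergent
   one. *)

(** * The quadratic character of -2 *)

(** Write q for the order of [F] and a = z^i with z a generator of the cyclic unit group:
    a^((q-1)/2) = 1 forces q - 1 to divide i (q-1)/2, so i is even and a is a square. *)
Lemma euler_criterion (F : finFieldType) (a : F) : odd #|F| -> a != 0 ->
  [exists x, x ^+ 2 == a] = (a ^+ #|F|./2 == 1).
Proof.
move=> oF a0.
have cF : #|F| = (#|F|./2).*2.+1 by rewrite -{1}[#|F|]odd_double_half oF.
apply/existsP/idP => [[x /eqP xa]|a1].
  have x0 : x != 0 by apply: contraNneq a0 => x0; rewrite -xa x0 expr0n.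
  apply/eqP/(mulIf x0); rewrite mul1r -xa -exprM -exprSr mul2n -cF.
  exact: expf_card.
have [z Gz] := cyclicP (field_unit_group_cyclic [set: {unit F}]%G).
have oz : #[z]%g = (#|F|./2).*2 by rewrite orderE -Gz card_finField_unit {1}cF.
have Ua : a \is a GRing.unit by rewrite unitfE.
have /cycleP[i ai] : FinRing.Unit Ua \in <[z]>%g by rewrite -Gz inE.
have ai' : a = \val z ^+ i by rewrite -FinRing.val_unitX -ai.
have : (#[z]%g %| i * #|F|./2)%N.
  rewrite order_dvdn; apply/eqP/val_inj; rewrite FinRing.val_unitX exprM -ai'.
  exact/eqP.
have F1 : (0 < #|F|./2)%N.
  by rewrite half_gt0; apply: card_finRing_gt1.
rewrite oz -mul2n dvdn_pmul2r// => /dvdnP[j ij].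
by exists (\val z ^+ j); rewrite -exprM -ij -ai'.
Qed.

Lemma fact_odd_even (m : nat) :
  m`! = (\prod_(i < m./2) i.+1.*2 * \prod_(i < uphalf m) i.*2.+1)%N.
Proof.
elim: m => [|m IH]; first by rewrite !big_ord0.
rewrite factS IH /= uphalf_half -[m.+1](odd_double_half m.+1) /= uphalf_half.
by case: (odd m); rewrite ?add0n add1n !big_ord_recr /= ?mul2n; ring.
Qed.

(* Gauss's lemma: modulo 2m+1, the numbers -2i for m/2 < i <= m are the odd
   numbers 2t+1 below m, with t = m-i. *)
Lemma exprN2_fact (R : comPzRingType) (m : nat) : m.*2.+1%:R = 0 :> R ->
  (-2) ^+ m * m`!%:R = (-1) ^+ m./2 * m`!%:R :> R.
Proof.
move=> m0; pose f (i : nat) : R := -2 * i.+1%:R.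
have -> : (-2) ^+ m * m`!%:R = \prod_(0 <= i < m) f i.
  rewrite big_mkord big_split /= prodr_const card_ord; congr (_ * _).
  by rewrite fact_prod natr_prod big_add1 big_mkord.
have em : m = (m./2 + uphalf m)%N by rewrite uphalf_half addnCA addnn odd_double_half.
rewrite fact_odd_even natrM !natr_prod mulrA [in LHS]em big_mkord big_split_ord /=.
congr (_ * _).
  under eq_bigr do rewrite /f mulNr -natrM mul2n.
  by rewrite prodrN card_ord.
rewrite (reindex_inj rev_ord_inj) /=; apply: eq_bigr => i _; rewrite /f.
have -> : (m./2 + (uphalf m - i.+1)).+1 = (m - i)%N.
  by have := ltn_ord i; lia.
have im : (i <= m)%N by have := ltn_ord i; lia.
rewrite natrB//.
move: m0; rewrite -[i.*2.+1]addn1 -[m.*2.+1]addn1 -!muln2 !natrD !natrM => h.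
rewrite -[LHS]addr0 -h; ring.
Qed.

(* The values at 1, 3, 5, 7 are 1, 1, -1, -1: the character of Q(sqrt -2). *)
Definition chi8 (n : nat) : int := if odd n then (-1) ^+ (n %/ 4) else 0.

Lemma chi8_mod8 (n : nat) : chi8 (n %% 8) = chi8 n.
Proof.
rewrite /chi8 [in RHS](divn_eq n 8) oddD oddM andbF /=; case: (odd _) => //.
rewrite -signr_odd -[in RHS]signr_odd; congr (_ ^+ _); lia.
Qed.

Lemma chi8M (m n : nat) : chi8 (m * n) = chi8 m * chi8 n.
Proof.
rewrite -chi8_mod8 -modnMm -(chi8_mod8 m) -(chi8_mod8 n).
have in8 i : (i %% 8)%N \in iota 0 8 by rewrite mem_iota ltn_pmod.
have /allP/(_ _ (in8 m))/allP/(_ _ (in8 n))/eqP// :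
  all (fun i => all (fun j => chi8 (i * j %% 8) == chi8 i * chi8 j) (iota 0 8))
    (iota 0 8) by vm_compute.
Qed.

(** For odd p, Euler's criterion turns the symbol into (-2)^m in F_p with m = (p-1)/2, and Gauss's
    lemma evaluates this power because m! is invertible modulo p. At p = 2 both sides vanish. *)
Lemma legendre_N2 (p : nat) : prime p -> legendre (-2) p = chi8 p.
Proof.
move=> pp; have chp := pchar_Fp pp.
have [->//|op] := even_prime pp.
have nd k : (0 < k < p)%N -> k%:R != 0 :> 'F_p.
  by move=> /andP[k0 kp]; rewrite -(dvdn_pcharf chp) gtnNdvd.
have p_gt2 := odd_prime_gt2 op pp.
have two : (-2)%:~R != 0 :> 'F_p by rewrite mulrNz oppr_eq0 nd.
have cF : #|'F_p| = p by exact: card_Fp.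
have pE : p = (p./2.*2.+1)%N by rewrite -{1}[p]odd_double_half op.
rewrite /legendre (dvdz_pcharf chp) (negbTE two).
have -> : [exists x : 'I_p, ((x : nat)%:Z ^+ 2 == -2 %[mod p])%Z] =
          [exists x : 'F_p, x ^+ 2 == (-2)%:~R].
  have eE (k : nat) : ((k%:Z ^+ 2 == -2 %[mod p])%Z) = ((k%:R : 'F_p) ^+ 2 == (-2)%:~R).
    by rewrite eqz_mod_dvd (dvdz_pcharf chp) rmorphB rmorphXn /= subr_eq0.
  apply/existsP/existsP => [[x]|[x]].
    by rewrite eE => h; exists (x : nat)%:R.
  move=> h; have xp : (x < p)%N by rewrite -[p in (_ < p)%N](Fp_cast pp).
  by exists (Ordinal xp); rewrite eE /= natr_Zp.
rewrite euler_criterion ?cF// /chi8 op.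
have mf : p./2`!%:R != 0 :> 'F_p.
  rewrite fact_prod natr_prod prodf_seq_neq0; apply/allP => i.
  by rewrite mem_index_iota /= => ?; apply: nd; lia.
have -> : (-2)%:~R ^+ p./2 = (-1) ^+ (p %/ 4) :> 'F_p.
  apply: (mulIf mf); rewrite (@exprN2_fact 'F_p).
    by rewrite (_ : p./2./2 = p %/ 4)%N//; lia.
  by rewrite -pE pchar_Fp_0.
rewrite -signr_odd -[in RHS]signr_odd.
case: (odd _); rewrite ?expr0 ?eqxx// expr1.
rewrite -subr_eq0 -opprD oppr_eq0 -mulr2n (negbTE (nd _ _))//; lia.
Qed.

(** * Abel summation and Chebyshev's bound *)

(** Summation by parts: with A the partial sums of a, the sum is A_n b_n plus the sum of A_(i+1)
    (b_i - b_(i+1)), whose bounds B (b_i - b_(i+1)) telescope. *)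
Lemma abel_le (R : realFieldType) (a b : nat -> R) (B : R) (m n : nat) :
  (forall i, (m <= i)%N -> b i.+1 <= b i) ->
  (forall i, (m <= i)%N -> 0 <= b i) ->
  (forall k, (m <= k)%N -> `|\sum_(m <= i < k) a i| <= B) ->
  `|\sum_(m <= i < n) a i * b i| <= B * b m.
Proof.
move=> bS b0 aB.
have B0 : 0 <= B by apply: le_trans (aB m _).
have [nm|mn] := ltnP n m.
  by rewrite big_geq ?(ltnW nm)// normr0 mulr_ge0 ?b0.
pose A k := \sum_(m <= i < k) a i.
suff H : `|\sum_(m <= i < n) a i * b i - A n * b n| <= B * (b m - b n).
  have h : `|A n * b n| <= B * b n.
    by rewrite normrM (ger0_norm (b0 _ mn)) ler_wpM2r ?b0 ?aB.
  rewrite -[X in `|X|](subrK (A n * b n)); apply: le_trans (ler_normD _ _) _.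
  by rewrite -[b m](subrK (b n)) mulrDr lerD.
elim: n mn => [|n IH].
  by rewrite leqn0 => /eqP ->; rewrite /A !big_geq// mul0r !subrr mulr0 normr0.
rewrite leq_eqVlt => /orP[/eqP<-|].
  by rewrite /A !big_geq// mul0r !subrr mulr0 normr0.
rewrite ltnS => mn.
have -> : \sum_(m <= i < n.+1) a i * b i - A n.+1 * b n.+1 =
  (\sum_(m <= i < n) a i * b i - A n * b n) + A n.+1 * (b n - b n.+1).
  by rewrite /A !big_nat_recr//=; ring.
have -> : B * (b m - b n.+1) = B * (b m - b n) + B * (b n - b n.+1) by ring.
apply: le_trans (ler_normD _ _) (lerD (IH mn) _).
have b1 : 0 <= b n - b n.+1 by rewrite subr_ge0 bS.
by rewrite normrM (ger0_norm b1) ler_wpM2r ?aB ?(leq_trans mn).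
Qed.

Lemma sum_chi8 (n : nat) : 0 <= \sum_(0 <= i < n) chi8 i <= 2.
Proof.
(* The partial sums have period 8, since a full period sums to 0; the list tabulates them. *)
suff -> : \sum_(0 <= i < n) chi8 i = nth 0 [:: 0; 0; 1; 1; 2; 2; 1; 1] (n %% 8).
  move: (ltn_pmod n (isT : 0 < 8)%N).
  by do 8?[case: (n %% 8)%N => [|n']|case: n' => [|n'] //].
elim: n => [|n IH]; first by rewrite big_geq.
rewrite big_nat_recr//= IH -chi8_mod8 -[n.+1]addn1 -[in RHS]modnDml.
move: (ltn_pmod n (isT : 0 < 8)%N).
by do 8?[case: (n %% 8)%N => [|n']|case: n' => [|n'] //].
Qed.

Lemma norm_sum_chi8 (R : realFieldType) (m n : nat) :
  `|\sum_(m <= i < n) (chi8 i)%:~R| <= 2 :> R.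
Proof.
have [nm|mn] := leqP n m; first by rewrite big_geq// normr0.
have /andP[n0 n2] := sum_chi8 n; have /andP[m0 m2] := sum_chi8 m.
move: n0 n2; rewrite (big_cat_nat _ (ltnW mn))//= => n0 n2.
rewrite -rmorph_sum /= -intr_norm (_ : 2 = 2%:~R)// ler_int ler_norml.
move: n0 n2 m0 m2; move: (\sum_(_ <= _ < n) _) (\sum_(_ <= _ < m) _) => x y.
by lia.
Qed.

Lemma norm_chi8 (n : nat) : `|chi8 n| <= 1.
Proof. by rewrite /chi8; case: ifP => _; rewrite ?normr0// normrX normrN1 expr1n. Qed.

Lemma norm_chi8R (R : realFieldType) (n : nat) : `|(chi8 n)%:~R| <= 1 :> R.
Proof. by rewrite -intr_norm (_ : 1 = 1%:~R)// ler_int norm_chi8. Qed.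

Lemma sum_dvdn_mul (R : pzRingType) (f : nat -> R) (q N : nat) : (0 < q)%N ->
  (forall m n, f (m * n)%N = f m * f n) ->
  \sum_(1 <= n < N.+1 | (q %| n)%N) f n = f q * \sum_(1 <= m < (N %/ q).+1) f m.
Proof.
move=> q0 fM; elim: N => [|N IH]; first by rewrite div0n !big_geq ?mulr0.
rewrite big_mkcond big_nat_recr//= -big_mkcond IH divnS//.
case: ifP => [qN|_]; last by rewrite addr0.
rewrite add1n [in RHS]big_nat_recr//= mulrDr -fM; congr (_ + f _).
by rewrite -(divnK qN) divnS// qN mulnC.
Qed.

Lemma ln_prod (R : realType) (I : Type) (s : seq I) (P : pred I) (f : I -> R) :
  (forall i, P i -> 0 < f i) ->
  ln (\prod_(i <- s | P i) f i) = \sum_(i <- s | P i) ln (f i).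
Proof.
move=> f0.
(* Positivity of the product is carried through the induction because [lnM] requires it. *)
suff [] : 0 < \prod_(i <- s | P i) f i /\
   ln (\prod_(i <- s | P i) f i) = \sum_(i <- s | P i) ln (f i) by [].
apply: (big_ind2 (fun x y => 0 < x /\ ln x = y)) => [|x _ y _ [x0 <-] [y0 <-]|i /f0//].
  by rewrite ln1.
by rewrite mulr_gt0// lnM.
Qed.

(** This is ln = Λ ∗ 1 for the von Mangoldt function Λ. The common cutoff K loses nothing: p^k | n
    forces p <= n and k < p^k <= n. *)
Lemma ln_natE (R : realType) (K n : nat) : (0 < n <= K)%N ->
  ln n%:R = \sum_(1 <= p < K.+1 | prime p) \sum_(1 <= k < K.+1)
    ln p%:R * (p ^ k %| n)%:R :> R.
Proof.
move=> /andP[n0 nK].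
transitivity (\sum_(1 <= p < K.+1 | prime p) ln p%:R *+ logn p n : R).
  have nE : n = (\prod_(1 <= p < K.+1) p ^ logn p n)%N.
    rewrite -[LHS](partnT n0) (widen_partn _ nK) (eq_bigl xpredT)// big_ltn//.
    by rewrite lognE mul1n.
  rewrite {1}nE natr_prod big_nat ln_prod => [|i /andP[i0 _]]; last first.
    by rewrite ltr0n expn_gt0 i0.
  rewrite -big_nat [RHS]big_mkcond [LHS]big_nat [RHS]big_nat.
  apply: eq_bigr => p /andP[p0 _]; rewrite natrX lnXn ?ltr0n//.
  by case: ifP => // pp; rewrite lognE pp.
apply: eq_bigr => p pp; rewrite -mulr_sumr -natr_sum logn_count_dvd// -[LHS]mulr_natr.
congr (_ * _%:R).
rewrite [RHS](big_cat_nat (n := n))//=; last by rewrite (leq_trans nK).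
rewrite [X in (_ + X)%N]big_nat [X in (_ + X)%N]big1 ?addn0// => k /andP[nk _].
apply/eqP; rewrite eqb0 gtnNdvd//; apply: leq_ltn_trans nk _.
exact/ltn_expl/prime_gt1.
Qed.

(** Expand ln n, exchange the sums, and factor the terms with p^k | n by complete multiplicativity.
    Taking f = 1 gives Chebyshev's formula for ln N!, and f = [chi8_div] gives Mertens' identity. *)
Lemma sum_mul_ln (R : realType) (f : nat -> R) (K N : nat) : (N <= K)%N ->
  (forall m n, f (m * n)%N = f m * f n) ->
  \sum_(1 <= n < N.+1) f n * ln n%:R =
  \sum_(1 <= p < K.+1 | prime p) \sum_(1 <= k < K.+1)
    ln p%:R * (f (p ^ k)%N * \sum_(1 <= m < (N %/ p ^ k).+1) f m).
Proof.
move=> NK fM; pose F n p k := f n * (ln p%:R * (p ^ k %| n)%:R).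
transitivity (\sum_(1 <= n < N.+1) \sum_(1 <= p < K.+1 | prime p)
    \sum_(1 <= k < K.+1) F n p k).
  apply: eq_big_nat => n /andP[n0 nN].
  rewrite (@ln_natE _ K) ?n0 ?(leq_trans _ NK)// mulr_sumr.
  by apply: eq_bigr => p _; rewrite mulr_sumr.
rewrite exchange_big /=; apply: eq_bigr => p pp.
rewrite exchange_big /=; apply: eq_bigr => k _.
rewrite -sum_dvdn_mul// ?expn_gt0 ?prime_gt0// [X in _ * X]big_mkcond mulr_sumr.
by apply: eq_bigr => n _; rewrite /F; case: ifP => _; rewrite ?mulr1 ?mulr0// mulrC.
Qed.

(* Chebyshev's function of N. Both indices run up to an independent K >= N, so
   that its values at two arguments can be compared term by term. *)
Definition psi (R : realType) (K N : nat) : R :=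
  \sum_(1 <= p < K.+1 | prime p) \sum_(1 <= k < K.+1)
    ln p%:R * (p ^ k <= N)%:R.

Lemma fact_half (N : nat) : (N`! <= 4 ^ N * N./2`! ^ 2)%N.
Proof.
(* The induction advances by two, which raises n./2 by one, so two consecutive cases are carried. *)
suff H n : (n`! <= 4 ^ n * n./2`! ^ 2)%N /\
    (n.+1`! <= 4 ^ n.+1 * n.+1./2`! ^ 2)%N by have [] := H N.
elim: n => [//|n [IH1 IH2]]; split=> //.
rewrite 2!factS (_ : n.+2./2 = n./2.+1)// factS !expnS.
have h : (n.+2 * n.+1 <= 16 * (n./2.+1 * n./2.+1))%N.
  have : (n.+1 <= 2 * n./2.+1)%N by lia.
  by nia.
rewrite (_ : (_ * (_ * _))%N = n.+2 * n.+1 * n`!)%N; last by ring.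
apply: leq_trans (leq_mul h IH1) _.
by rewrite expnS !expn1 expn0 muln1; apply: eq_leq; ring.
Qed.

Lemma ln_nat_ge0 (R : realType) (n : nat) : 0 <= ln n%:R :> R.
Proof.
by case: n => [|n]; [rewrite ln0|rewrite ln_ge0// ler1n].
Qed.

(** Chebyshev's argument: T(N) = ln N! is the sum of ln p floor(N / p^k), and T(N) - 2 T(N/2) <= N
    ln 4 by [fact_half]. Termwise, floor(N/q) - 2 floor(N/(2q)) is nonnegative, and it is 1 when N/2
    < q <= N. *)
Lemma psi_half (R : realType) (K N : nat) : (N <= K)%N ->
  psi R K N <= psi R K N./2 + N%:R * ln 4.
Proof.
move=> NK; pose T n : R := \sum_(1 <= i < n.+1) 1 * ln i%:R.
have TE n : (n <= K)%N -> T n = \sum_(1 <= p < K.+1 | prime p)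
    \sum_(1 <= k < K.+1) ln p%:R * (n %/ p ^ k)%:R.
  move=> nK; rewrite /T (@sum_mul_ln _ (fun=> 1) K)// => [|_ _]; last by rewrite mulr1.
  by apply: eq_bigr => p _; apply: eq_bigr => k _; rewrite mul1r sumr_const_nat subn1.
have Tfact n : T n = ln n`!%:R.
  rewrite fact_prod natr_prod big_nat ln_prod => [|i]; last by rewrite ltr0n => /andP[].
  by rewrite -big_nat; apply: eq_bigr => i _; rewrite mul1r.
have N2K : (N./2 <= K)%N by lia.
have : T N - 2 * T N./2 <= N%:R * ln 4.
  rewrite !Tfact lerBlDr.
  have -> : N%:R * ln 4 + 2 * ln N./2`!%:R = ln (4 ^ N * N./2`! ^ 2)%:R :> R.
    rewrite natrM !natrX lnM ?posrE ?exprn_gt0 ?ltr0n ?fact_gt0//.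
    by rewrite !lnXn ?ltr0n ?fact_gt0// mulr_natl (mulr_natl _ 2).
  rewrite ler_ln ?posrE ?ltr0n ?fact_gt0// ?muln_gt0 ?expn_gt0 ?fact_gt0//.
  by rewrite ler_nat fact_half.
rewrite !TE// -lerBlDl; apply: le_trans.
rewrite mulr_sumr -!sumrB; apply: ler_sum => p pp.
rewrite mulr_sumr -!sumrB; apply: ler_sum => k _.
rewrite mulrCA -!mulrBr ler_wpM2l ?ln_nat_ge0//.
rewrite lerBlDr addrAC lerBrDr -natrM -!natrD ler_nat.
have q0 : (0 < p ^ k)%N by rewrite expn_gt0 prime_gt0.
move: (p ^ k)%N q0 => q q0.
have -> : (N./2 %/ q = (N %/ q)./2)%N by rewrite -!divn2 divnAC.
have : (N < q)%N || (0 < N %/ q)%N by rewrite divn_gt0//; case: ltnP.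
have : ((N %/ q)./2 == 0)%N || (q <= N./2)%N.
  by rewrite -!divn2 divnAC -leqn0 leqNgt divn_gt0//; case: leqP.
lia.
Qed.

(** Iterated halving yields N + N/2 + N/4 + ... <= 2N. *)
Lemma psi_le (R : realType) (K N : nat) : (N <= K)%N ->
  psi R K N <= 2 * N%:R * ln 4.
Proof.
elim/ltn_ind: N => -[_ _|N IH NK].
  rewrite mulr0 mul0r /psi big1// => p pp; rewrite big1// => k _.
  by rewrite leqn0 expn_eq0 -leqn0 leqNgt prime_gt0// mulr0.
apply: le_trans (psi_half _ _ _ NK) _.
have h : (N.+1./2 < N.+1)%N by lia.
have := IH _ h (leq_trans (ltnW h) NK).
have ln4 : 0 <= ln (4%:R : R) by exact: ln_nat_ge0.
have : (2 * N.+1./2)%:R <= N.+1%:R :> R by rewrite ler_nat; lia.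
rewrite natrM; nra.
Qed.

(** * Mertens' estimate for chi8 *)

Definition chi8_div (R : fieldType) (n : nat) : R := (chi8 n)%:~R / n%:R.

Lemma chi8_divM (R : fieldType) (m n : nat) :
  chi8_div R (m * n) = chi8_div R m * chi8_div R n.
Proof. by rewrite /chi8_div chi8M rmorphM natrM invfM /= mulrACA. Qed.

Lemma norm_chi8_div (R : realFieldType) (n : nat) : `|chi8_div R n| <= n%:R^-1.
Proof.
rewrite /chi8_div normrM normfV normr_nat -[leRHS]mul1r.
by rewrite ler_wpM2r ?invr_ge0 ?norm_chi8R.
Qed.

(** Lets an estimate valid only from some index m on serve for sums starting earlier, at the cost of
    a constant. *)
Lemma sum_bounded_tail (R : realFieldType) (t : nat -> R) (k m : nat) (B : R) :
  (k <= m)%N ->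
  (forall n, (m <= n)%N -> `|\sum_(m <= i < n) t i| <= B) ->
  forall n, `|\sum_(k <= i < n) t i| <= \sum_(k <= i < m) `|t i| + B.
Proof.
move=> km tB n; have B0 : 0 <= B by apply: le_trans (tB m _).
have [mn|nm] := leqP m n.
  rewrite (big_cat_nat km mn) /=; apply: le_trans (ler_normD _ _) _.
  by rewrite lerD ?tB ?ler_norm_sum.
have [nk|kn] := leqP n k.
  by rewrite big_geq// normr0 addr_ge0// sumr_ge0.
rewrite (big_cat_nat (ltnW kn) (ltnW nm)) /= -addrA.
apply: le_trans (ler_norm_sum _ _ _) _.
by rewrite lerDl addr_ge0 ?sumr_ge0.
Qed.

Lemma chi8_series_tail (R : realFieldType) (m n : nat) :
  `|\sum_(m.+1 <= i < n) chi8_div R i| <= 2 / m.+1%:R.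
Proof.
apply: (@abel_le R _ (fun i => i%:R^-1)) => [i mi|i mi|k _].
- by rewrite lef_pV2 ?posrE ?ltr0n ?ler_nat//; lia.
- by rewrite invr_ge0.
- exact: norm_sum_chi8.
Qed.

(* Positivity of L(1, chi8) can be read off its first four terms: their sum
   1 + 1/3 exceeds the bound 2/5 on the tail. *)
Lemma chi8_L1 (R : realType) : exists2 L : R, 0 < L &
  forall n, `|L - \sum_(1 <= i < n.+1) chi8_div R i| <= 2 / n.+1%:R.
Proof.
pose S n := \sum_(1 <= i < n.+1) chi8_div R i; pose e n : R := 2 / n.+1%:R.
have e0 n : 0 <= e n by rewrite divr_ge0.
(* Every lower end S m - e m lies below every upper end S n + e n, so the supremum of the lower ends
   lies in all these intervals. *)
have le_Se m n : S m - e m <= S n + e n.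
  have [mn|nm] := leqP m n.
    have := chi8_series_tail R m n.+1.
    rewrite ler_norml => /andP[h _]; have {h} := h; rewrite -/(e m).
    rewrite /S [X in _ -> _ <= X + _](big_cat_nat (n := m.+1))//=.
    by have := e0 n; lra.
  have := chi8_series_tail R n m.+1.
  rewrite ler_norml => /andP[_]; rewrite -/(e n).
  rewrite /S [X in _ -> X - _ <= _](big_cat_nat (n := n.+1))//=; last by rewrite ltnS ltnW.
  by have := e0 m; lra.
pose E : set R := range (fun n => S n - e n).
have E0 : (E !=set0)%classic by exists (S 0 - e 0), 0%N.
have ubE n : ubound E (S n + e n) by move=> _ [m _ <-].
have L1 n : S n - e n <= sup E.
  by apply: ub_le_sup; [exists (S 0 + e 0)|exists n].
have L2 n : sup E <= S n + e n by apply: ge_sup.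
exists (sup E); last first.
  move=> n; rewrite -/(S n) -/(e n) ler_norml.
  by have := L1 n; have := L2 n; lra.
apply: lt_le_trans (L1 4%N).
have -> : S 4%N = 1 + 1 / 3.
  rewrite /S 3?big_nat_recr//= big_nat1 /chi8_div.
  rewrite (_ : chi8 1%N = 1)// (_ : chi8 2%N = 0)// (_ : chi8 3%N = 1)//.
  by rewrite (_ : chi8 4%N = 0)//; field.
by rewrite /e; lra.
Qed.

Lemma ln_succ_le (R : realType) (n : nat) : (0 < n)%N ->
  ln n.+1%:R <= ln n%:R + n%:R^-1 :> R.
Proof.
move=> n0; have n0' : (0 : R) < n%:R by rewrite ltr0n.
have -> : n.+1%:R = n%:R * (1 + n%:R^-1) :> R.
  by rewrite mulrDr mulr1 divff ?gt_eqF// -natr1.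
have h : 0 < n%:R^-1 :> R by rewrite invr_gt0.
rewrite lnM ?posrE ?addr_gt0// lerD2l le_ln1Dx// (lt_trans _ h)// ltrN10.
Qed.

(** Comes from ln (1/2) <= -1/2. It is what makes ln n / n nonincreasing from n = 4 on. *)
Lemma ln4_ge1 (R : realType) : 1 <= ln 4 :> R.
Proof.
have -> : 4 = (2^-1 ^+ 2)^-1 :> R by field.
rewrite lnV ?posrE// lnXn//.
have : ln (1 + - 2^-1) <= - 2^-1 :> R by apply: le_ln1Dx; lra.
have -> : 1 + - 2^-1 = 2^-1 :> R by field.
by move: (ln _) => l; lra.
Qed.

Lemma ln_div_nonincreasing (R : realType) (n : nat) : (4 <= n)%N ->
  ln n.+1%:R / n.+1%:R <= ln n%:R / n%:R :> R.
Proof.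
move=> n4; have n0 : (0 < n)%N by lia.
have n0' : (0 : R) < n%:R by rewrite ltr0n.
rewrite ler_pdivrMr ?ltr0n// mulrAC ler_pdivlMr//.
have h : 1 <= ln n%:R :> R.
  by rewrite (le_trans (ln4_ge1 R))// ler_ln ?posrE// ler_nat.
apply: le_trans (ler_wpM2r (ltW n0') (ln_succ_le R n n0)) _.
by rewrite mulrDl mulVf ?gt_eqF// -natr1 mulrDr mulr1 lerD2l.
Qed.

Lemma sum_chi8_ln_bounded (R : realType) : exists C : R, forall n,
  `|\sum_(1 <= i < n) chi8_div R i * ln i%:R| <= C.
Proof.
(* From index 4 on, Abel summation bounds the tail by 2, the bound on character sums, times the
   first weight ln 4 / 4. *)
eexists => n; apply: (@sum_bounded_tail R _ 1 4 (2 * (ln 4 / 4))) => // {}n _.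
under eq_bigr do rewrite /chi8_div -mulrA [_^-1 * _]mulrC.
apply: (@abel_le R _ (fun i => ln i%:R / i%:R)) => [i i4|i i4|k _].
- exact: ln_div_nonincreasing.
- by rewrite divr_ge0 ?ln_nat_ge0.
- exact: norm_sum_chi8.
Qed.

Lemma sum_exprV_le (R : realFieldType) (p n : nat) : (1 < p)%N ->
  \sum_(2 <= k < n) (p%:R^-1) ^+ k <= (p%:R * (p%:R - 1))^-1 :> R.
Proof.
move=> p1; have p1' : (1 : R) < p%:R by rewrite ltr1n.
have p0 : (0 : R) < p%:R by lra.
set x : R := p%:R^-1; have x0 : 0 < x by rewrite invr_gt0.
have xp : p%:R = x^-1 by rewrite invrK.
have x1 : 0 < 1 - x by rewrite subr_gt0 invf_lt1.
have [n2|n2] := leqP n 2.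
  by rewrite big_geq// invr_ge0 mulr_ge0//; lra.
have -> : (p%:R * (p%:R - 1))^-1 = x ^+ 2 / (1 - x).
  by rewrite xp; field; rewrite !gt_eqF.
rewrite ler_pdivlMr//.
have -> : (\sum_(2 <= k < n) x ^+ k) * (1 - x) = x ^+ 2 - x ^+ n.
  rewrite mulr_suml -[LHS]opprK -sumrN.
  under eq_bigr do rewrite mulrBr mulr1 -exprSr opprB.
  by rewrite telescope_sumr ?opprB// ltnW.
by rewrite gerBl exprn_ge0// ltW.
Qed.

Lemma sum_ln_div_le (R : realType) (n : nat) :
  \sum_(2 <= i < n) ln i%:R / (i%:R * (i%:R - 1)) <= 2 :> R.
Proof.
case: n => [|[|n]]; [by rewrite big_geq|by rewrite big_geq|].
(* With N = n + 1, the remainder (ln N + 2) / N is modelled on (ln N + 1) / N, the integral of ln x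
   / x^2 from N on; the extra 1/N absorbs the discretization. For N = 1 the bound is 0, matching the
   empty sum. *)
suff : \sum_(2 <= i < n.+2) ln i%:R / (i%:R * (i%:R - 1)) <=
  2 - (ln n.+1%:R + 2) / n.+1%:R :> R.
  move/le_trans; apply; rewrite gerBl divr_ge0// addr_ge0 ?ln_nat_ge0//.
elim: n => [|n IH]; first by rewrite big_geq// ln1; lra.
rewrite big_nat_recr//=; apply: le_trans (lerD IH (lexx _)) _.
have := ln_succ_le R n.+1 isT; set a : R := n.+1%:R.
have a0 : 0 < a by rewrite ltr0n.
have a1 : 1 <= a by rewrite ler1n.
rewrite -(natr1 n.+1) -/a addrK => h; clearbody a.
rewrite -addrA lerD2l -subr_ge0.
have -> : - ((ln (a + 1) + 2) / (a + 1)) - (- ((ln a + 2) / a) + ln (a + 1) / ((a + 1) * a)) =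
  ((a + 1) * (ln a - ln (a + 1)) + 2) / (a * (a + 1)).
  by field; rewrite !gt_eqF//; lra.
rewrite divr_ge0//; last by rewrite mulr_ge0//; lra.
have : (a + 1) * (ln a - ln (a + 1)) >= (a + 1) * - a^-1.
  by rewrite ler_wpM2l//; lra.
have : a^-1 <= 1 by rewrite invf_le1.
rewrite mulrN mulrDl mul1r divff ?gt_eqF//; lra.
Qed.

Lemma sum_prime_chi8_ln_bounded (R : realType) : exists C : R, forall n,
  `|\sum_(1 <= p < n | prime p) chi8_div R p * ln p%:R| <= C.
Proof.
have [C0 HC0] := sum_chi8_ln_bounded R; have [L L0 HL] := chi8_L1 R.
(* [C0] bounds the sum of chi8(n) (ln n) / n, 4 ln 4 the error of replacing its inner sums by L, and
   2 the prime powers with k >= 2. *)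
exists ((C0 + 4 * ln 4) / L + 2); case=> [|N].
  rewrite big_geq// normr0 addr_ge0// divr_ge0 ?(ltW L0)// addr_ge0//.
    exact: le_trans (HC0 0).
  by rewrite mulr_ge0// ln_nat_ge0.
have [->|N0] := posnP N.
  rewrite big_geq// normr0 addr_ge0// divr_ge0 ?(ltW L0)// addr_ge0//.
    exact: le_trans (HC0 0).
  by rewrite mulr_ge0// ln_nat_ge0.
have N0' : 0 < N%:R :> R by rewrite ltr0n.
pose u p k : R := ln p%:R * (chi8_div R (p ^ k) * (p ^ k <= N)%:R).
pose U : R := \sum_(1 <= p < N.+1 | prime p) \sum_(1 <= k < N.+1) u p k.
set V := \sum_(_ <= _ < _ | _) _.
(* For q = p^k <= N, replacing the inner sum up to N/q by L costs at most 2q/N, and the factor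
   chi8(q)/q brings this to 2/N. Weighted by ln p, the errors total at most (2/N) psi(N) <= 4 ln 4.
   For q > N both terms vanish. *)
have LU : `|L * U - \sum_(1 <= i < N.+1) chi8_div R i * ln i%:R| <= 4 * ln 4.
  rewrite (@sum_mul_ln _ _ N)//; last exact: chi8_divM.
  rewrite /U mulr_sumr -sumrB; apply: le_trans (ler_norm_sum _ _ _) _.
  apply: (@le_trans _ _ (2 / N%:R * psi R N N)); last first.
    rewrite mulrAC ler_pdivrMr//; have := psi_le R N N (leqnn _); lra.
  rewrite /psi mulr_sumr; apply: ler_sum => p pp.
  rewrite !mulr_sumr -sumrB; apply: le_trans (ler_norm_sum _ _ _) _.
  apply: ler_sum => k _.
  have q0 : (0 < p ^ k)%N by rewrite expn_gt0 prime_gt0.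
  rewrite /u mulrCA -mulrBr normrM (ger0_norm (ln_nat_ge0 _ _)) [leRHS]mulrCA.
  rewrite ler_wpM2l ?ln_nat_ge0//; move: (p ^ k)%N q0 => q q0.
  have q0' : 0 < q%:R :> R by rewrite ltr0n.
  case: leqP => [qN|Nq]; last first.
    by rewrite divn_small// big_geq// !mulr0 subrr normr0.
  rewrite !mulr1 mulrC -mulrBr normrM.
  apply: le_trans (ler_pM _ _ (norm_chi8_div _ _) (HL _)) _ => //.
  rewrite mulrCA ler_wpM2l// -invfM lef_pV2 ?posrE ?mulr_gt0 ?ltr0n//.
  rewrite -natrM ler_nat mulnC; exact/ltnW/ltn_ceil.
(* The terms k = 1 of U form V; for each p the others are dominated by the geometric tail 1 / (p (p
   - 1)) times ln p. *)
have UV : `|U - V| <= 2.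
  rewrite /U /V -sumrB.
  apply: le_trans (ler_norm_sum _ _ _) _.
  apply: le_trans (sum_ln_div_le R N.+1).
  rewrite [X in X <= _]big_ltn_cond//= big_mkcond big_nat [leRHS]big_nat.
  apply: ler_sum => p /andP[p2 pN]; have p1' : (1 : R) < p%:R by rewrite ltr1n.
  case: ifP => pp; last first.
    by rewrite divr_ge0 ?ln_nat_ge0// mulr_ge0//; lra.
  rewrite big_ltn// /u expn1 -ltnS pN mulr1 [X in X - _]addrC mulrC addrK.
  rewrite -mulr_sumr normrM (ger0_norm (ln_nat_ge0 _ _)) ler_wpM2l ?ln_nat_ge0//.
  apply: le_trans (ler_norm_sum _ _ _) _; apply: le_trans (sum_exprV_le R p N.+1 p2).
  apply: ler_sum => k _; rewrite normrM exprVn -natrX.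
  apply: le_trans (_ : `|chi8_div R (p ^ k)| * 1 <= _); last by rewrite mulr1 norm_chi8_div.
  by rewrite ler_wpM2l//; case: leqP; rewrite ?normr1 ?normr0.
have -> : V = U - (U - V) by ring.
apply: le_trans (ler_normB _ _) (lerD _ UV).
rewrite ler_pdivlMr// mulrC -{1}(gtr0_norm L0) -normrM.
have := HC0 N.+1; move: LU; set G := \sum_(_ <= _ < _) _ => LU HG.
have -> : L * U = G + (L * U - G) by ring.
by apply: le_trans (ler_normD _ _) (lerD HG LU).
Qed.

(** * The Euler product *)

(** Both sides come from ln (1 + t) <= t: the upper one at t = -x, the lower one from 1/(1 - x) = 1
    + x/(1 - x), using x/(1 - x) = x + x^2/(1 - x) and 1/(1 - x) <= 2. *)
Lemma norm_ln1B_le (R : realType) (x : R) : `|x| <= 2^-1 ->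
  `|ln (1 - x) + x| <= 2 * x ^+ 2.
Proof.
rewrite ler_norml => /andP[x1 x2].
have y0 : 0 < 1 - x by lra.
have h1 : ln (1 - x) <= - x by apply: le_ln1Dx; lra.
have yV : (1 - x)^-1 <= 2.
  by rewrite -[leRHS]invrK lef_pV2 ?posrE ?invr_gt0//; lra.
have h2 : - ln (1 - x) <= x / (1 - x).
  have -> : x / (1 - x) = (1 - x)^-1 - 1 by field; rewrite gt_eqF.
  have v0 : 0 < (1 - x)^-1 by rewrite invr_gt0.
  rewrite -lnV ?posrE// -{1}[_^-1](addrNK 1) addrC.
  by apply: le_ln1Dx; lra.
have h3 : x / (1 - x) = x + x ^+ 2 / (1 - x) by field; rewrite gt_eqF.
have h4 : x ^+ 2 / (1 - x) <= x ^+ 2 * 2 by rewrite ler_wpM2l ?sqr_ge0.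
have h5 := sqr_ge0 x.
by rewrite ler_norml; apply/andP; split; lra.
Qed.

(** The error is quadratic in 1/q; the bound takes the form of a difference so that it telescopes
    when summed over q. The hypothesis 3 <= q puts c/(q - 1) in the range of [norm_ln1B_le]. *)
Lemma norm_euler_factor_le (R : realType) (c q : R) : `|c| <= 1 -> 3 <= q ->
  `|ln (1 - c / (q - 1)) + c / q| <= 8 * ((q - 1)^-1 - q^-1).
Proof.
move=> c1 q3; set y := (q - 1)^-1.
have q0 : 0 < q by lra.
have y0 : 0 < y by rewrite invr_gt0; lra.
have yq : y * (q - 1) = 1 by rewrite mulVf// gt_eqF//; lra.
have zE : y - q^-1 = y * q^-1 by rewrite /y; field; rewrite !gt_eqF//; lra.
have z0 : 0 < q^-1 by rewrite invr_gt0.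
have zq : q^-1 * q = 1 by rewrite mulVf// gt_eqF.
have y2 : y <= 2^-1 by rewrite lef_pV2 ?posrE//; lra.
have yz : y <= 2 * q^-1 by nra.
have x1 : `|c * y| <= 2^-1.
  by rewrite normrM (gtr0_norm y0); have := normr_ge0 c; nra.
have x2 : (c * y) ^+ 2 <= y ^+ 2.
  rewrite exprMn -[leRHS]mul1r ler_wpM2r ?sqr_ge0//.
  by rewrite -real_normK ?num_real// expr_le1.
have h := norm_ln1B_le _ _ x1.
have -> : ln (1 - c * y) + c / q = (ln (1 - c * y) + c * y) - c * (y - q^-1) by ring.
apply: le_trans (ler_normB _ _) _.
have yz0 : 0 <= y - q^-1 by rewrite zE mulr_ge0// ltW.
have h' : `|c * (y - q^-1)| <= y - q^-1 by rewrite normrM (ger0_norm yz0) ler_piMl.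
have : 2 * (c * y) ^+ 2 <= 4 * (y - q^-1) by rewrite zE; nra.
lra.
Qed.

Lemma sum_coprime_chi8_ln_bounded (R : realType) (d : int) : d != 0 ->
  exists C : R, forall n,
  `|\sum_(1 <= p < n | prime p && ~~ (p %| d)%Z) chi8_div R p * ln p%:R| <= C.
Proof.
move=> d0; have [C HC] := sum_prime_chi8_ln_bounded R.
eexists => n; rewrite big_mkcond.
(* No prime above |d| divides d, so from |d| + 1 on the condition is vacuous and the sum is a
   difference of two sums over all primes. *)
apply: (@sum_bounded_tail R _ 1 `|d|%N.+1 (C + C)) => // {}n dn.
rewrite big_nat_cond -big_mkcondr /=.
rewrite (eq_bigl (fun p => (`|d| < p < n)%N && prime p)); last first.
  move=> p; rewrite andbT; case: (boolP (_ < p < n)%N) => //= /andP[dp _].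
  rewrite dvdzE /= gtnNdvd ?andbT//; by rewrite absz_gt0.
rewrite -big_nat_cond.
have -> : \sum_(`|d|.+1 <= p < n | prime p) chi8_div R p * ln p%:R =
  \sum_(1 <= p < n | prime p) chi8_div R p * ln p%:R -
  \sum_(1 <= p < `|d|.+1 | prime p) chi8_div R p * ln p%:R.
  by rewrite [X in _ = X - _](big_cat_nat (n := `|d|.+1))//= addrC addrK.
exact: le_trans (ler_normB _ _) (lerD (HC _) (HC _)).
Qed.

Lemma norm_legendre (a : int) (p : nat) : `|legendre a p| <= 1.
Proof. by rewrite /legendre; case: ifP => _; [|case: ifP]. Qed.

(** The partial products are exponentials of the partial sums of [u], so it suffices that this
    series is Cauchy, and the limit, being an exponential, is positive. *)
Lemma h2_partial_cvg (R : realType) (r : int) : r != 0 ->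
  exists2 l : R, 0 < l & (h2_partial R r @ \oo --> l)%classic.
Proof.
move=> r0; pose P (p : nat) := prime p && ~~ (p %| 2 * r)%Z.
have d0 : 2 * r != 0 by rewrite mulf_neq0.
(* The prime 2 divides 2r and is thus excluded; this keeps every factor positive and its logarithm
   meaningful. *)
have P3 p : P p -> (3 <= p)%N.
  move=> /andP[pp]; rewrite ltn_neqAle prime_gt1// andbT; apply: contraNneq => <-.
  exact: dvdz_mulr.
pose x (p : nat) : R := (legendre (-2) p)%:~R / (p%:R - 1).
pose u (p : nat) : R := if P p then ln (1 - x p) else 0.
pose a (p : nat) : R := if P p then chi8_div R p else 0.
have lN p : `|(legendre (-2) p)%:~R| <= 1 :> R.
  by rewrite -intr_norm (_ : 1 = 1%:~R)// ler_int norm_legendre.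
have x1 p : P p -> 0 < 1 - x p.
  move=> /P3 p3; have p3' : 3 <= p%:R :> R by rewrite ler_nat.
  have := lN p; rewrite /x; set c : R := _%:~R => c1.
  rewrite subr_gt0 ltr_pdivrMr; last by lra.
  by have := ler_norm c; lra.
have hE : h2_partial R r = expR \o series u.
  apply/funext => N; rewrite /h2_partial /series /= big_mkcond expR_sum.
  apply: eq_bigr => p _; rewrite -/(P p) /u; case: ifP => [/x1 xp|_]; last by rewrite expR0.
  by rewrite lnK.
have [C HC] := sum_coprime_chi8_ln_bounded R (2 * r) d0.
have C0 : 0 <= C by apply: le_trans (HC 0%N).
have ln_gt0' m : (2 <= m)%N -> 0 < ln m%:R :> R by move=> m2; rewrite ln_gt0// ltr1n.
(* Abel summation of the bounded sums of chi8(p) (ln p) / p against 1 / ln p, with 2 <= m to keep ln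
   m positive. *)
have aB m n : (2 <= m)%N -> `|\sum_(m <= p < n) a p| <= (C + C) / ln m%:R.
  move=> m2.
  have -> : \sum_(m <= p < n) a p = \sum_(m <= p < n)
    (if P p then chi8_div R p * ln p%:R else 0) * (ln p%:R)^-1.
    rewrite big_nat [RHS]big_nat; apply: eq_bigr => p /andP[mp _]; rewrite /a.
    case: ifP; rewrite ?mul0r// mulfK// gt_eqF// ln_gt0'//; exact: leq_trans mp.
  apply: (@abel_le R _ (fun p => (ln p%:R)^-1)) => [i mi|i mi|k mk].
  - rewrite lef_pV2 ?posrE ?ln_gt0'//; [|lia|lia].
    by rewrite ler_ln ?posrE ?ltr0n ?ler_nat//; lia.
  - by rewrite invr_ge0 ln_nat_ge0.
  - rewrite -big_mkcond.
    have -> : \sum_(m <= p < k | P p) chi8_div R p * ln p%:R =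
      \sum_(1 <= p < k | P p) chi8_div R p * ln p%:R -
      \sum_(1 <= p < m | P p) chi8_div R p * ln p%:R.
      by rewrite [X in _ = X - _](big_cat_nat (n := m))//= ?(ltnW m2)// addrC addrK.
    exact: le_trans (ler_normB _ _) (lerD (HC _) (HC _)).
(* The terms of u + a are dominated by a telescoping sum of total at most 8 / (m - 1), and ln m <= m
   - 1. *)
have uB m n : (2 <= m)%N -> `|\sum_(m <= p < n) u p| <= (C + C + 8) / ln m%:R.
  move=> m2; have [nm|mn] := leqP n m.
    by rewrite big_geq// normr0 divr_ge0 ?addr_ge0 ?ln_nat_ge0.
  have -> : \sum_(m <= p < n) u p = \sum_(m <= p < n) (u p + a p) - \sum_(m <= p < n) a p.
    by rewrite big_split /= addrK.
  apply: le_trans (ler_normB _ _) _; rewrite addrC mulrDl lerD ?aB//.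
  apply: le_trans (ler_norm_sum _ _ _) _.
  have m1 : 0 < m%:R - 1 :> R by rewrite subr_gt0 ltr1n.
  apply: (@le_trans _ _ (8 * (m%:R - 1)^-1)); last first.
    rewrite ler_pM2l// lef_pV2 ?posrE ?ln_gt0'//.
    have := @le_ln1Dx R (m%:R - 1); rewrite [1 + _]addrC subrK; apply.
    by apply: lt_trans m1; rewrite ltrN10.
  apply: (@le_trans _ _ (8 * ((m%:R - 1)^-1 - (n%:R - 1)^-1))); last first.
    rewrite ler_pM2l// gerBl invr_ge0 subr_ge0 ler1n; lia.
  have -> : (m%:R - 1)^-1 - (n%:R - 1)^-1 = \sum_(m <= p < n) ((p%:R - 1)^-1 - p%:R^-1) :> R.
    rewrite -[LHS]opprB -(@telescope_sumr R m n (fun p => (p%:R - 1)^-1)) 1?ltnW//.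
    by rewrite -sumrN; apply: eq_bigr => p _; rewrite opprB -natr1 addrK.
  rewrite mulr_sumr [leLHS]big_nat [leRHS]big_nat.
  apply: ler_sum => p /andP[mp _]; rewrite /u /a.
  case: ifP => [Pp|_].
    have /andP[pp _] := Pp; rewrite /chi8_div -legendre_N2//.
    by apply: norm_euler_factor_le; rewrite ?lN// ler_nat P3.
  have p1 : 0 < p%:R - 1 :> R by rewrite subr_gt0 ltr1n (leq_trans m2).
  rewrite addr0 normr0 mulr_ge0// subr_ge0 lef_pV2 ?posrE//.
    by rewrite gerBl.
  by rewrite ltr0n; lia.
have cu : cvgn (series u).
  apply: cauchy_cvg; apply/cauchy_seriesP => e e0.
  (* Beyond [M], m exceeds exp(D/e), so D / ln m < e; the added 2 ensures 2 <= m. The bound is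
     uniform in the upper end n, which is left unrestricted. *)
  pose D := C + C + 8; pose M := (Num.bound (expR (D / e))).+2.
  exists ([set n | (M <= n)%N], setT)%classic.
    by split; [exists M|exact: filterT].
  move=> [m n] /= [Mm _]; have m2 : (2 <= m)%N by apply: leq_trans Mm.
  apply: le_lt_trans (uB _ _ m2) _; rewrite -/D.
  rewrite ltr_pdivrMr ?ln_gt0'// mulrC -ltr_pdivrMr//.
  rewrite -ltr_expR lnK ?posrE ?ltr0n//; last by lia.
  apply: lt_le_trans (archi_boundP (expR_ge0 _)) _.
  by rewrite ler_nat; apply: leq_trans Mm; rewrite /M leqW.
exists (expR (limn (series u))); first exact: expR_gt0.
by rewrite hE; apply: continuous_cvg cu; exact: continuous_expR.
Qed.

Lemma h2_gt0 (R : realType) (r : int) : r != 0 -> 0 < h2 R r.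
Proof.
move=> /(h2_partial_cvg R)[l l0 hl].
by rewrite /h2 (cvg_lim _ hl)// mulr_gt0// sqrtr_gt0.
Qed.

(** * Bounds on the bracket, and positivity of the constant *)

Lemma norm_prod_le1 (R : numDomainType) (I : eqType) (s : seq I) (P : pred I)
    (f : I -> R) :
  {in s, forall i, `|f i| <= 1} -> `|\prod_(i <- s | P i) f i| <= 1.
Proof.
move=> f1; rewrite big_seq_cond.
apply: (big_ind (fun x => `|x| <= 1)) => [|x y x1 y1|i /andP[/f1//]].
  by rewrite normr1.
by rewrite normrM mulr_ile1.
Qed.

Lemma norm_jacobi (a : int) (n : nat) : `|jacobi a n| <= 1.
Proof.
by apply: norm_prod_le1 => p _; rewrite normrX exprn_ile1// norm_legendre.
Qed.

Lemma norm_Omega2 (R : realType) (n : nat) (r : int) : `|Omega2 R n r| <= 1.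
Proof.
apply: norm_prod_le1 => p; rewrite mem_primes => /andP[pp _].
rewrite legendre_N2// normrM normrN1 mul1r normfV.
suff h : 1 <= p%:R - 1 - (chi8 p)%:~R :> R.
  by rewrite ger0_norm ?invf_le1//; lra.
(* At p = 2 the symbol vanishes and the denominator is exactly 1. *)
have [->|op] := even_prime pp; first by rewrite (_ : chi8 2 = 0)//; lra.
have : 3 <= p%:R :> R by rewrite ler_nat odd_prime_gt2.
by have := le_trans (ler_norm _) (norm_chi8R R p); lra.
Qed.

Theorem theorem7p4 (R : realType) (r : int) (hr : (r = 2 %[mod 4])%Z)
    (g : int) (hg : g != 0) :
  0 < varpi R (cm2_curve hg) r.
Proof.
have r0 : r != 0 by apply/eqP => r0; move: hr; rewrite r0.
rewrite /varpi cm2_twist_curve; set e := varpi_sign_exp _ _.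
rewrite mulr_gt0// ?divr_gt0 ?h2_gt0//.
set j : R := (jacobi _ _)%:~R; set w : R := Omega2 _ _ _.
have j1 : `|j| <= 1.
  by rewrite -intr_norm (_ : 1 = 1%:~R)// ler_int norm_jacobi.
have e1 : `|(-1) ^ e| = 1 :> R.
  by case: e => n; rewrite /exprz ?normfV normrX normrN1 expr1n ?invr1.
have : `|1 / 2 * (-1) ^ e * j * w| <= 1 / 2.
  rewrite !normrM e1 mulr1 normr1 normfV normr_nat mul1r -mulrA.
  by rewrite ler_piMr// mulr_ile1// norm_Omega2.
by rewrite ler_norml => /andP[h _]; lra.
Qed.
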